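(* The ES and weak ES properties are distinct, even for locally finite varieties of Brouwerian or Heyting algebras having width $2$. That is, there is a locally finite variety of Brouwerian algebras of width $2$ that has the weak ES property but not the ES property, and there is a locally finite variety of Heyting algebras of width $2$ that has the weak ES property but not the ES property.
   Context: A Brouwerian algebra is an algebra $\langle A;\to,\wedge,\vee,\top\rangle$ whose $\wedge,\vee$ reduct is a lattice with greatest element $\top$ and in which $x\wedge y\leqslant z\iff x\leqslant y\to z$. A Heyting algebra is a Brouwerian algebra with a distinguished least element $\bot$. A variety is locally finite if its finitely generated members are finite. Filters are non-empty lattice filters; a filter is prime if its complement is closed under $\vee$. The dual of a Heyting algebra is (as a poset) the set of its proper prime filters ordered by inclusion; the dual of a Brouwerian algebra is the set of all its prime filters, including the improper filter, ordered by inclusion. An algebra is finitely subdirectly irreducible if its identity relation is meet-irreducible in its congruence lattice (for Brouwerian and Heyting algebras: $\top$ is join-irreducible). The width of a variety $\mathsf{K}$ of Brouwerian or Heyting algebras is the supremum of the cardinalities of antichains in the duals of the finitely subdirectly irreducible members of $\mathsf{K}$. A class $\mathsf{K}$ of similar algebras is regarded as a category whose morphisms are all algebraic homomorphisms between members of $\mathsf{K}$. A $\mathsf{K}$-morphism $h\colon A\to B$ is a $\mathsf{K}$-epimorphism if, for all $\mathsf{K}$-morphisms $f,g$ from $B$ to a single member of $\mathsf{K}$, $f\circ h=g\circ h$ implies $f=g$. $\mathsf{K}$ has the ES property if every $\mathsf{K}$-epimorphism is surjective. A homomorphism $h\colon A\to B$ is almost-onto if $B$ is generated by $h[A]\cup\{b\}$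 for some $b\in B$; $\mathsf{K}$ has the weak ES property if every almost-onto $\mathsf{K}$-epimorphism is surjective. *)

(* Defs.v *)
From mathcomp Require Import all_boot.
From mathcomp Require Import boolp classical_sets functions cardinality.

Set Implicit Arguments.
Unset Strict Implicit.
Unset Printing Implicit Defensive.

Local Open Scope classical_set_scope.
Local Open Scope card_scope.

Record signature := Signature { symbol : Type; arity : symbol -> nat }.

Record algebra (S : signature) := Algebra {
  carrier :> Type;
  op : forall f : symbol S, ('I_(arity f) -> carrier) -> carrier }.

Arguments op {S A} f args : rename.

Section UniversalAlgebra.
Variable S : signature.
Implicit Types (A B C : algebra S) (K : algebra S -> Prop).

Inductive term : Type :=
| Var of nat
| App (f : symbol S) of ('I_(arity f) -> term).

Fixpoint eval A (v : nat -> A) (t : term) : A :=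
  match t with
  | Var n => v n
  | App f ts => op f (fun i => eval v (ts i))
  end.

Definition satisfies A (s t : term) := forall v : nat -> A, eval v s = eval v t.

(* Varieties are equational classes. *)
Definition variety K :=
  exists E : term -> term -> Prop,
    forall A, K A <-> (forall s t, E s t -> satisfies A s t).

Definition homomorphism A B (h : A -> B) :=
  forall (f : symbol S) (args : 'I_(arity f) -> A),
    h (op f args) = op f (h \o args).

Definition subuniverse A (X : set A) :=
  forall (f : symbol S) (args : 'I_(arity f) -> A),
    (forall i, X (args i)) -> X (op f args).

Definition generated A (X : set A) : set A := smallest (@subuniverse A) X.

Definition finitely_generated A :=
  exists2 X : set A, finite_set X & generated X = [set: A].

Definition locally_finite K :=
  forall A, K A -> finitely_generated A -> finite_set [set: A].

Record congruence A (theta : set (A * A)) : Prop := {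
  cong_refl : forall x, theta (x, x);
  cong_sym : forall x y, theta (x, y) -> theta (y, x);
  cong_trans : forall x y z, theta (x, y) -> theta (y, z) -> theta (x, z);
  cong_op : forall (f : symbol S) (a b : 'I_(arity f) -> A),
    (forall i, theta (a i, b i)) -> theta (op f a, op f b) }.

(* Meets of congruences are intersections.  Meet-irreducibility is not taken to
   exclude the top of the lattice, so trivial algebras qualify. *)
Definition finitely_subdirectly_irreducible A :=
  forall theta1 theta2 : set (A * A),
    congruence theta1 -> congruence theta2 ->
    theta1 `&` theta2 = diagonal -> theta1 = diagonal \/ theta2 = diagonal.

Definition epimorphism K A B (h : A -> B) :=
  forall C, K C -> forall f g : B -> C,
    homomorphism f -> homomorphism g -> f \o h = g \o h -> f = g.

Definition almost_onto A B (h : A -> B) :=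
  exists b : B, generated (range h `|` [set b]) = [set: B].

Definition ES_property K :=
  forall A B (h : A -> B), K A -> K B -> homomorphism h ->
    epimorphism K h -> range h = [set: B].

Definition weak_ES_property K :=
  forall A B (h : A -> B), K A -> K B -> homomorphism h ->
    almost_onto h -> epimorphism K h -> range h = [set: B].

Definition antichain (T : Type) (X : set (set T)) :=
  forall F G, X F -> X G -> F `<=` G -> F = G.

(* [dual A] is the set of points of the dual poset of [A], ordered by
   inclusion. *)
Definition antichains_bounded (dual : forall A, set (set A)) K (n : nat) :=
  forall A, K A -> finitely_subdirectly_irreducible A ->
  forall X : set (set A), X `<=` dual A -> antichain X -> X #<= `I_n.

(* A supremum of cardinals which is finite is the least natural number bounding
   all of them. *)
Definition has_width (dual : forall A, set (set A)) K (n : nat) :=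
  antichains_bounded dual K n /\
  forall m, antichains_bounded dual K m -> n <= m.

End UniversalAlgebra.

Variant brouwerian_symbol := Imp | Meet | Join | Top.

Definition brouwerian_arity (f : brouwerian_symbol) : nat :=
  match f with Imp | Meet | Join => 2 | Top => 0 end.

Definition brouwerian_signature := Signature brouwerian_arity.

Section Brouwerian.
Variable A : algebra brouwerian_signature.

Definition args0 (T : Type) (i : 'I_0) : T := False_rect T (notF (valP i)).
Definition args2 (T : Type) (x y : T) (i : 'I_2) : T :=
  if i == ord0 then x else y.

Definition imp (x y : A) : A := @op _ A Imp (args2 x y).
Definition meet (x y : A) : A := @op _ A Meet (args2 x y).
Definition join (x y : A) : A := @op _ A Join (args2 x y).
Definition top : A := @op _ A Top (@args0 A).
Definition le (x y : A) : Prop := meet x y = x.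

Record brouwerian_algebra : Prop := {
  meetC : commutative meet;
  meetA : associative meet;
  joinC : commutative join;
  joinA : associative join;
  meetJK : forall x y, meet x (join x y) = x;
  joinMK : forall x y, join x (meet x y) = x;
  le_top : forall x, le x top;
  le_imp : forall x y z, le (meet x y) z <-> le x (imp y z) }.

Record lattice_filter (F : set A) : Prop := {
  filter_nonempty : F !=set0;
  filter_up : forall x y, F x -> le x y -> F y;
  filter_meet : forall x y, F x -> F y -> F (meet x y) }.

Definition prime_filter (F : set A) :=
  lattice_filter F /\ forall x y, ~ F x -> ~ F y -> ~ F (join x y).

(* The improper filter is a point of the dual. *)
Definition brouwerian_dual : set (set A) := [set F | prime_filter F].

End Brouwerian.

Variant heyting_symbol := Brouwerian of brouwerian_symbol | Bot.

Definition heyting_arity (f : heyting_symbol) : nat :=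
  match f with Brouwerian g => brouwerian_arity g | Bot => 0 end.

Definition heyting_signature := Signature heyting_arity.

Section Heyting.
Variable A : algebra heyting_signature.

Definition brouwerian_reduct : algebra brouwerian_signature :=
  @Algebra brouwerian_signature A
    (fun f : brouwerian_symbol => @op _ A (Brouwerian f)).

Definition bot : A := @op _ A Bot (@args0 A).

Definition heyting_algebra :=
  brouwerian_algebra brouwerian_reduct /\
  forall x : brouwerian_reduct, le (bot : brouwerian_reduct) x.

Definition heyting_dual : set (set A) :=
  [set F : set brouwerian_reduct | prime_filter F /\ F <> setT].

End Heyting.

(* Main.v *)
Require Import Defs.
From mathcomp Require Import all_boot.
From mathcomp Require Import boolp classical_sets functions cardinality.

(** Call a Brouwerian algebra layered if it satisfies the identity
    [(x -> y) \/ (y -> x) \/ (x -> z) \/ (z -> x) \/ (y <-> z) = top].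
    In a finitely subdirectly irreducible algebra the top is join-irreducible, so
    there the identity says that an element is incomparable with at most one other
    element: such an algebra is a linear sum of points and four-element diamonds.
    The two varieties wanted are those of layered Brouwerian algebras and of
    Heyting algebras with a layered reduct.

    Width 2 is immediate: three pairwise incomparable prime filters would give
    three pairwise incomparable elements ([prime_antichain]).  For local
    finiteness, closing a finite set under passage to the other corners of a
    diamond already gives a subalgebra, so the irreducible quotients of a finitely
    generated algebra have bounded size and there are finitely many of them
    ([finite_hull], [locally_finite_layered_brouwerian]).

    The weak ES property holds in every variety of Brouwerian algebras: if [B] is
    generated by a proper subalgebra [Y] and an element [b], then [B] modulo the
    filter generated by the elements of [Y] above [b] receives two homomorphisms
    from [B] which agree on [Y] and differ at [b] ([proper_almost_onto_not_epi]).

    The ES property fails for the algebra [B] of up-sets of the tower, the poset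
    made of a root below an ascending sequence of two-element antichains.  Between
    its top and its bottom, [B] is an infinite descending sum of diamonds.  One side [l n]
    of each diamond, together with the top and the bottom, forms a subalgebra [A]
    which is a chain.  Its inclusion is an epimorphism: in an irreducible layered
    algebra, where an incomparable partner is unique, the images of the [l n]
    determine those of the other sides [r n] ([diamonds_unique]).  The argument for
    the [n]-th diamond looks at the one below it, hence the infinite descent of
    [B].  Dually, the inclusion comes from a p-morphism onto the chain of natural
    numbers which glues points of consecutive layers in a zigzag ([zigzag]).

    For Heyting algebras the same maps serve.  A Brouwerian homomorphism from a
    Heyting algebra becomes a Heyting homomorphism when the image of [bot] is named
    by the constant ([expand]), so everything transfers from reducts. *)

Set Implicit Arguments.
Unset Strict Implicit.
Unset Printing Implicit Defensive.

Local Open Scope classical_set_scope.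
Local Open Scope card_scope.

(** * Homomorphic images and quotients *)

Section Quotients.
Variable S : signature.
Implicit Types A B C : algebra S.

Lemma eval_hom A B (h : A -> B) (v : nat -> A) (t : term S) :
  homomorphism h -> h (eval v t) = eval (h \o v) t.
Proof.
move=> hh; elim: t => [//|f ts IH] /=; rewrite hh.
by congr (op f _); apply/funext => i /=.
Qed.

Lemma hom_comp A B C (g : B -> C) (h : A -> B) :
  homomorphism g -> homomorphism h -> homomorphism (g \o h).
Proof. by move=> hg hh f args; rewrite /= hh hg. Qed.

Lemma variety_image K A B (h : A -> B) :
  variety K -> homomorphism h -> (forall y, exists x, h x = y) -> K A -> K B.
Proof.
move=> [E KE] hh sh /KE KA; apply/KE => s t /KA st v.
have [r hr] := choice (fun n => sh (v n)).
have -> : v = h \o r by apply/funext => n /=; rewrite hr.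
by rewrite -!eval_hom // st.
Qed.

Lemma quotient_exists A (theta : set (A * A)) : congruence theta ->
  exists C (q : A -> C), homomorphism q /\ (forall c, exists a, q a = c) /\
    (forall a b, q a = q b <-> theta (a, b)).
Proof.
move=> [Rf Sy Tr Op].
pose cls a : set A := [set x | theta (a, x)].
have clsE a b : cls a = cls b <-> theta (a, b).
  split=> [e|ab]; first by have : cls b b by [apply: Rf]; rewrite -e.
  by apply/seteqP; split=> x /=; apply: Tr; first apply: Sy.
pose T := {c : set A | exists a, c = cls a}.
pose q a : T := exist _ (cls a) (ex_intro _ a erefl).
have qE a b : q a = q b <-> theta (a, b).
  by rewrite -clsE; split=> [[]//|e]; apply: eq_exist.
have sq c : exists a, q a = c by case: c => c [a ac]; exists a; apply: eq_exist.
have [r rK] := choice sq.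
exists (@Algebra S T (fun f args => q (op f (r \o args)))), q.
split; last by split.
by move=> f args /=; apply/qE/Op => i; apply/qE; rewrite /= rK.
Qed.

End Quotients.

(** * Generated subalgebras *)

Section Generation.
Variable S : signature.
Implicit Types A B : algebra S.

Lemma generated_subuniverse A (X : set A) : subuniverse (generated X).
Proof.
by move=> f args Xargs Y [sY XY]; exact: (sY f args (fun i => Xargs i Y (conj sY XY))).
Qed.

Lemma generated_ind A (X Y : set A) : generated X = [set: A] -> subuniverse Y ->
  X `<=` Y -> forall a, Y a.
Proof.
move=> gX sY XY a; have : [set: A] a by [].
by rewrite -gX; apply: smallest_sub.
Qed.

Lemma range_subuniverse A B (h : A -> B) : homomorphism h -> subuniverse (range h).
Proof.
move=> hh f args argsP.
have ex i : exists x, h x = args i by have [x _ <-] := argsP i; exists x.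
have [x xE] := choice ex.
by exists (op f x); rewrite // hh; congr (op f _); apply/funext => i /=.
Qed.

Lemma almost_onto_range A B (h : A -> B) b :
  homomorphism h -> generated (range h `|` [set b]) = [set: B] -> range h b ->
  range h = [set: B].
Proof.
move=> hh genB hb; apply/seteqP; split=> // y _; move: y.
by apply: (generated_ind genB); [apply: range_subuniverse|move=> y [//|->]].
Qed.

End Generation.

(** * Brouwerian algebras as ordered sets *)

Section Residuated.
Variable A : algebra brouwerian_signature.
Hypothesis BA : brouwerian_algebra A.
Implicit Types x y z u v w : A.

Local Notation "x <<= y" := (le x y) (at level 70).

Lemma meetxx x : meet x x = x.
Proof. by rewrite -{2}(joinMK BA x x) meetJK. Qed.

Lemma le_refl x : x <<= x. Proof. exact: meetxx. Qed.

Lemma le_trans y x z : x <<= y -> y <<= z -> x <<= z.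
Proof. by rewrite /le => xy yz; rewrite -xy -(meetA BA) yz. Qed.

Lemma le_anti x y : x <<= y -> y <<= x -> x = y.
Proof. by rewrite /le (meetC BA) => -> ->. Qed.

Lemma leIl x y : meet x y <<= x.
Proof. by rewrite /le (meetC BA x) -(meetA BA) meetxx. Qed.

Lemma leIr x y : meet x y <<= y.
Proof. by rewrite (meetC BA); apply: leIl. Qed.

Lemma lexI z x y : z <<= x -> z <<= y -> z <<= meet x y.
Proof. by rewrite /le (meetA BA) => ->. Qed.

Lemma leUl x y : x <<= join x y. Proof. exact: meetJK. Qed.

Lemma leUr x y : y <<= join x y.
Proof. by rewrite (joinC BA); apply: leUl. Qed.

Lemma join_r x y : x <<= y -> join x y = y.
Proof. by move=> xy; rewrite (joinC BA) -{1}xy (meetC BA) (joinMK BA). Qed.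

Lemma joinxx x : join x x = x. Proof. exact/join_r/le_refl. Qed.

Lemma leUx x y z : x <<= z -> y <<= z -> join x y <<= z.
Proof.
move=> /join_r xz /join_r yz.
by have := leUl (join x y) z; rewrite -(joinA BA) yz xz.
Qed.

Lemma leIxy x y x' y' : x <<= x' -> y <<= y' -> meet x y <<= meet x' y'.
Proof.
by move=> xx yy; apply: lexI;
  [apply: le_trans xx; apply: leIl|apply: le_trans yy; apply: leIr].
Qed.

Lemma meetx1 x : meet x (top A) = x. Proof. exact: le_top. Qed.

Lemma meet1x x : meet (top A) x = x. Proof. by rewrite (meetC BA) meetx1. Qed.

Lemma top_le x : top A <<= x -> x = top A.
Proof. by rewrite /le meet1x. Qed.

Lemma join1x x : join (top A) x = top A.
Proof. by apply/top_le/leUl. Qed.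

Lemma le_impI x y z : meet x y <<= z -> x <<= imp y z.
Proof. by move=> h; apply/(le_imp BA). Qed.

Lemma le_impE x y z : x <<= imp y z -> meet x y <<= z.
Proof. by move=> h; apply/(le_imp BA). Qed.

Lemma impP x y : imp x y = top A <-> x <<= y.
Proof.
split=> [e|xy]; last by apply/top_le/le_impI; rewrite meet1x.
by rewrite -(meet1x x); apply: le_impE; rewrite e; apply: le_refl.
Qed.

Lemma modus_ponens x y : meet (imp x y) x <<= y.
Proof. by apply/le_impE/le_refl. Qed.

Lemma le_impr x y : y <<= imp x y.
Proof. by apply/le_impI/leIl. Qed.

Lemma meet_join_le x y z w :
  meet x y <<= w -> meet x z <<= w -> meet x (join y z) <<= w.
Proof.
rewrite !(meetC BA x) => xy xz; apply/le_impE/leUx; exact/le_impI.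
Qed.

(** Having the same meet with [g] means being identified by the principal
    filter of [g].  These relations, which do not mention implication, serve
    throughout to describe the congruence of a filter. *)
Lemma meet_imp_cong g x y x' y' : meet g x = meet g x' -> meet g y = meet g y' ->
  meet g (imp x y) = meet g (imp x' y').
Proof.
suff half a b a' b' : meet g a = meet g a' -> meet g b = meet g b' ->
    meet g (imp a b) <<= meet g (imp a' b').
  by move=> xx yy; apply: le_anti; apply: half.
move=> aa bb; apply: lexI; first exact: leIl.
apply: le_impI; apply: (@le_trans (meet g b)); last by rewrite bb; apply: leIr.
have le_g : meet (meet g (imp a b)) a' <<= g.
  by apply: le_trans (leIl _ _) (leIl _ _).
apply: lexI => //.
have le_a : meet (meet g (imp a b)) a' <<= a.
  apply: (@le_trans (meet g a)); last exact: leIr.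
  by rewrite aa; apply: lexI => //; apply: leIr.
apply: le_trans (modus_ponens a b); apply: lexI => //.
by apply: le_trans (leIl _ _) (leIr _ _).
Qed.

Lemma meet_meet_cong g x y x' y' : meet g x = meet g x' -> meet g y = meet g y' ->
  meet g (meet x y) = meet g (meet x' y').
Proof.
suff E a b : meet g (meet a b) = meet (meet g a) (meet g b).
  by move=> xx yy; rewrite !E xx yy.
apply: le_anti.
  by apply: lexI; apply: leIxy; rewrite /le ?meetxx //; [apply: leIl|apply: leIr].
by apply: lexI; [apply: le_trans (leIl _ _) (leIl _ _)|apply: leIxy; apply: leIr].
Qed.

Lemma meet_join_cong g x y x' y' : meet g x = meet g x' -> meet g y = meet g y' ->
  meet g (join x y) = meet g (join x' y').
Proof.
suff half a b a' b' : meet g a = meet g a' -> meet g b = meet g b' ->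
    meet g (join a b) <<= meet g (join a' b').
  by move=> xx yy; apply: le_anti; apply: half.
move=> aa bb; apply: lexI; first exact: leIl.
by apply: meet_join_le; rewrite ?aa ?bb; apply: le_trans (leIr _ _) _;
  [apply: leUl|apply: leUr].
Qed.

End Residuated.

(** * Homomorphisms and filter congruences *)

Lemma args2E T (a : 'I_2 -> T) : a = args2 (a ord0) (a ord_max).
Proof.
apply/funext => i; rewrite /args2; case: eqP => [->//|/eqP i0].
by congr a; apply: val_inj; case: i i0 => -[|[]].
Qed.

Lemma args0E T (a b : 'I_0 -> T) : a = b.
Proof. by apply/funext => -[]. Qed.

Lemma comp_args2 T U (h : T -> U) x y : h \o args2 x y = args2 (h x) (h y).
Proof. by apply/funext => i; rewrite /args2 /=; case: ifP. Qed.

Section Homomorphisms.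
Variables A B : algebra brouwerian_signature.
Implicit Type h : A -> B.

Lemma hom_imp h : homomorphism h -> forall x y, h (imp x y) = imp (h x) (h y).
Proof. by move=> hh x y; rewrite /imp -comp_args2; apply: hh. Qed.

Lemma hom_meet h : homomorphism h -> forall x y, h (meet x y) = meet (h x) (h y).
Proof. by move=> hh x y; rewrite /meet -comp_args2; apply: hh. Qed.

Lemma hom_join h : homomorphism h -> forall x y, h (join x y) = join (h x) (h y).
Proof. by move=> hh x y; rewrite /join -comp_args2; apply: hh. Qed.

Lemma hom_top h : homomorphism h -> h (top A) = top B.
Proof. by move=> hh; rewrite /top hh; congr (op _ _); apply: args0E. Qed.

Lemma build_hom h : (forall x y, h (imp x y) = imp (h x) (h y)) ->
  (forall x y, h (meet x y) = meet (h x) (h y)) ->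
  (forall x y, h (join x y) = join (h x) (h y)) -> h (top A) = top B ->
  homomorphism h.
Proof.
move=> hI hM hJ hT [] /= args.
- by rewrite (args2E args) comp_args2; apply: hI.
- by rewrite (args2E args) comp_args2; apply: hM.
- by rewrite (args2E args) comp_args2; apply: hJ.
- by rewrite [args](args0E _ (@args0 A)) [_ \o _](args0E _ (@args0 B)).
Qed.

Lemma build_subuniverse (X : set A) : (forall x y, X x -> X y -> X (imp x y)) ->
  (forall x y, X x -> X y -> X (meet x y)) ->
  (forall x y, X x -> X y -> X (join x y)) -> X (top A) -> subuniverse X.
Proof.
move=> XI XM XJ XT [] /= args Xa.
- by rewrite (args2E args); apply: XI.
- by rewrite (args2E args); apply: XM.
- by rewrite (args2E args); apply: XJ.
- by rewrite [args](args0E _ (@args0 A)).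
Qed.

End Homomorphisms.

Lemma filter_congruence (A : algebra brouwerian_signature) (G : set A) :
  brouwerian_algebra A -> lattice_filter G ->
  congruence [set p : A * A | exists2 g, G g & meet g p.1 = meet g p.2].
Proof.
move=> BA [[g0 Gg0] Gup GM].
have widen (g h x y : A) : meet g x = meet g y -> meet (meet g h) x = meet (meet g h) y.
  by move=> e; rewrite (meetC BA g) -!(meetA BA) e.
have both (x y x' y' : A) : (exists2 g, G g & meet g x = meet g y) ->
    (exists2 g, G g & meet g x' = meet g y') ->
    exists2 g, G g & meet g x = meet g y /\ meet g x' = meet g y'.
  move=> [g Gg e] [h Gh e']; exists (meet g h); first exact: GM.
  by split; [|rewrite (meetC BA g)]; apply: widen.
split=> /=.
- by move=> x; exists g0.
- by move=> x y [g Gg e]; exists g.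
- move=> x y z xy yz; have [g Gg [e e']] := both _ _ _ _ xy yz.
  by exists g; rewrite // e.
- have bin (a b : 'I_2 -> A) :
      (forall i, exists2 g, G g & meet g (a i) = meet g (b i)) ->
      exists2 g, G g & meet g (a ord0) = meet g (b ord0) /\
        meet g (a ord_max) = meet g (b ord_max).
    by move=> ab; apply: both.
  case=> /= a b; last by rewrite [a](args0E _ b); exists g0.
  + move=> /bin [g Gg [e0 e1]]; rewrite (args2E a) (args2E b).
    by exists g => //; apply: meet_imp_cong.
  + move=> /bin [g Gg [e0 e1]]; rewrite (args2E a) (args2E b).
    by exists g => //; apply: meet_meet_cong.
  + move=> /bin [g Gg [e0 e1]]; rewrite (args2E a) (args2E b).
    by exists g => //; apply: meet_join_cong.
Qed.

Lemma principal_filter (A : algebra brouwerian_signature) (g : A) :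
  brouwerian_algebra A -> lattice_filter [set x | le g x].
Proof.
move=> BA; split=> /=; first by exists g; apply: le_refl.
- by move=> x y gx; apply: le_trans.
- by move=> x y; apply: lexI.
Qed.

(** * The variety of layered Brouwerian algebras *)

Definition well_connected (A : algebra brouwerian_signature) :=
  forall x y : A, join x y = top A -> x = top A \/ y = top A.

(** In a well-connected algebra this identity says that one of its five joinands
    is the top: either [x] is comparable with [y], or it is comparable with [z],
    or [y = z]. *)
Definition layered_law (A : algebra brouwerian_signature) :=
  forall x y z : A, join (imp x y) (join (imp y x) (join (imp x z)
    (join (imp z x) (meet (imp y z) (imp z y))))) = top A.

Definition layered_brouwerian (A : algebra brouwerian_signature) :=
  brouwerian_algebra A /\ layered_law A.

Section EquationalBasis.

Let T := term brouwerian_signature.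
Let tI (s t : T) : T := @App brouwerian_signature Imp (args2 s t).
Let tM (s t : T) : T := @App brouwerian_signature Meet (args2 s t).
Let tJ (s t : T) : T := @App brouwerian_signature Join (args2 s t).
Let tT : T := @App brouwerian_signature Top (@args0 T).
Let x0 : T := Var _ 0.
Let y0 : T := Var _ 1.
Let z0 : T := Var _ 2.

Let evalI (A : algebra brouwerian_signature) (v : nat -> A) s t :
  eval v (tI s t) = imp (eval v s) (eval v t).
Proof. by rewrite /imp -comp_args2. Qed.
Let evalM (A : algebra brouwerian_signature) (v : nat -> A) s t :
  eval v (tM s t) = meet (eval v s) (eval v t).
Proof. by rewrite /meet -comp_args2. Qed.
Let evalJ (A : algebra brouwerian_signature) (v : nat -> A) s t :
  eval v (tJ s t) = join (eval v s) (eval v t).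
Proof. by rewrite /join -comp_args2. Qed.
Let evalT (A : algebra brouwerian_signature) (v : nat -> A) : eval v tT = top A.
Proof. by rewrite /top /=; congr (op _ _); apply: args0E. Qed.
Let evalE := (evalI, evalM, evalJ, evalT).

(** The equational basis consists of all identities valid in the class.
    Residuation, the one axiom that is not an identity, follows from
    [y <= x -> y], from [x -> x = top], from [x /\ (x -> y) = x /\ y] and from
    the preservation of meets by [x -> _]. *)
Lemma variety_layered_brouwerian : variety layered_brouwerian.
Proof.
exists (fun s t => forall A, layered_brouwerian A -> satisfies A s t) => A.
split=> [KA s t|H]; first exact.
have id3 s t : (forall (B : algebra brouwerian_signature) (v : nat -> B),
      layered_brouwerian B -> eval v s = eval v t) ->
    forall x y z : A, eval (nth x [:: x; y; z]) s = eval (nth x [:: x; y; z]) t.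
  by move=> e x y z; apply: H => B KB v; apply: e.
have mC (x y : A) : meet x y = meet y x.
  have := id3 (tM x0 y0) (tM y0 x0) _ x y x; rewrite !evalE; apply.
  by move=> B v [BB _]; rewrite !evalE (meetC BB).
have jC (x y : A) : join x y = join y x.
  have := id3 (tJ x0 y0) (tJ y0 x0) _ x y x; rewrite !evalE; apply.
  by move=> B v [BB _]; rewrite !evalE (joinC BB).
have mA (x y z : A) : meet x (meet y z) = meet (meet x y) z.
  have := id3 (tM x0 (tM y0 z0)) (tM (tM x0 y0) z0) _ x y z; rewrite !evalE; apply.
  by move=> B v [BB _]; rewrite !evalE (meetA BB).
have jA (x y z : A) : join x (join y z) = join (join x y) z.
  have := id3 (tJ x0 (tJ y0 z0)) (tJ (tJ x0 y0) z0) _ x y z; rewrite !evalE; apply.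
  by move=> B v [BB _]; rewrite !evalE (joinA BB).
have mJ (x y : A) : meet x (join x y) = x.
  have := id3 (tM x0 (tJ x0 y0)) x0 _ x y x; rewrite !evalE; apply.
  by move=> B v [BB _]; rewrite !evalE (meetJK BB).
have jM (x y : A) : join x (meet x y) = x.
  have := id3 (tJ x0 (tM x0 y0)) x0 _ x y x; rewrite !evalE; apply.
  by move=> B v [BB _]; rewrite !evalE (joinMK BB).
have m1 (x : A) : meet x (top A) = x.
  have := id3 (tM x0 tT) x0 _ x x x; rewrite !evalE; apply.
  by move=> B v [BB _]; rewrite !evalE meetx1.
have ixx (x : A) : imp x x = top A.
  have := id3 (tI x0 x0) tT _ x x x; rewrite !evalE; apply.
  by move=> B v [BB _]; rewrite !evalE; apply/(impP BB)/le_refl.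
have mp (x y : A) : meet x (imp x y) = meet x y.
  have := id3 (tM x0 (tI x0 y0)) (tM x0 y0) _ x y x; rewrite !evalE; apply.
  move=> B v [BB _]; rewrite !evalE; apply: (le_anti BB).
    by apply: lexI => //; [apply: leIl|rewrite (meetC BB); apply: modus_ponens].
  by apply: leIxy => //; [apply: le_refl|apply: le_impr].
have wk (x y : A) : meet y (imp x y) = y.
  have := id3 (tM y0 (tI x0 y0)) y0 _ x y x; rewrite !evalE; apply.
  by move=> B v [BB _]; rewrite !evalE; apply: le_impr.
have dist (x y z : A) : imp x (meet y z) = meet (imp x y) (imp x z).
  have := id3 (tI x0 (tM y0 z0)) (tM (tI x0 y0) (tI x0 z0)) _ x y z.
  rewrite !evalE; apply; move=> B v [BB _]; rewrite !evalE; apply: (le_anti BB).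
    by apply: lexI => //; apply: le_impI => //; apply: le_trans (modus_ponens BB _ _) _;
      rewrite //; [apply: leIl|apply: leIr].
  by apply: le_impI => //; apply: lexI => //; apply: le_impE => //; [apply: leIl|apply: leIr].
split; last first.
  move=> x y z.
  have := id3 (tJ (tI x0 y0) (tJ (tI y0 x0) (tJ (tI x0 z0)
    (tJ (tI z0 x0) (tM (tI y0 z0) (tI z0 y0)))))) tT _ x y z.
  by rewrite !evalE; apply; move=> B v [_ LB]; rewrite !evalE; apply: LB.
split=> // x y z; rewrite /le; split=> h.
  have e : imp y (meet x y) = imp y x by rewrite dist ixx m1.
  have e' : imp y x = meet (imp y x) (imp y z) by rewrite -{1}e -h dist e.
  by rewrite -{1}(wk y x) -mA -e' wk.
have e : meet x y = meet x (meet y z) by rewrite -{1}h -mA [meet (imp _ _) y]mC mp.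
by rewrite -mA -e.
Qed.

End EquationalBasis.

(** * Separation by well-connected quotients *)

Section Separation.
Variable A : algebra brouwerian_signature.
Implicit Types a b : A.

Lemma prime_separation a b : brouwerian_algebra A -> ~ le a b ->
  exists P : set A, [/\ prime_filter P, P a & ~ P b].
Proof.
move=> BA nab.
(* Neither membership of [a] nor non-emptiness is required of a candidate, so
   that the union of the empty chain is one; both hold at a maximal candidate. *)
pose cand (F : set A) := [/\ forall x y, F x -> F y -> F (meet x y),
  forall x y, F x -> le x y -> F y & forall x, F x -> ~ le (meet a x) b].
have [M [[MM Mup Mab] Mmax]] : exists M, cand M /\ forall N, M `<` N -> ~ cand N.
  apply: Zorn_bigcup => F Fcand Ftot; split.
  - move=> x y [X FX Xx] [Y FY Yy]; have [XY|YX] := Ftot _ _ FX FY.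
      by exists Y => //; have [YM _ _] := Fcand _ FY; apply: YM => //; apply: XY.
    by exists X => //; have [XM _ _] := Fcand _ FX; apply: XM => //; apply: YX.
  - move=> x y [X FX Xx] xy; exists X => //.
    by have [_ Xup _] := Fcand _ FX; apply: Xup xy.
  - by move=> x [X FX Xx]; have [_ _] := Fcand _ FX; apply.
have out y : ~ M y -> exists x, (x = top A \/ M x) /\ le (meet a (meet x y)) b.
  move=> nMy; apply: contrapT => none.
  pose N := [set z | exists x, (x = top A \/ M x) /\ le (meet x y) z].
  apply: (Mmax N).
    split=> [x Mx|]; first by exists x; split; [right|apply: leIl].
    by move=> NM; apply/nMy/NM; exists (top A); split; [left|apply: leIr].
  split.
  - move=> z w [x [xM xz]] [x' [xM' xw]]; exists (meet x x'); split.
      case: xM xM' => [->|Mx] [->|Mx']; rewrite ?meetx1 ?meet1x //;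
        [by left|by right|by right|].
      by right; apply: MM.
    by apply: lexI => //; [apply: le_trans xz|apply: le_trans xw] => //;
      apply: leIxy => //; by [apply: le_refl|apply: leIl|apply: leIr].
  - by move=> z w [x [xM xz]] zw; exists x; split => //; apply: le_trans zw.
  - move=> z [x [xM xz]] azb; apply: none; exists x; split=> //.
    by apply: le_trans azb => //; apply: leIxy => //; apply: le_refl.
have axb x : x = top A \/ M x -> ~ le (meet a x) b.
  by case=> [->|]; [rewrite meetx1|apply: Mab].
have M1 : M (top A).
  by apply: contrapT => /out [x [/axb xM]]; rewrite meetx1.
have inM x : x = top A \/ M x -> M x by case=> [->|].
exists M; split.
- split; first by split=> //; exists (top A).
  move=> y z /out [x [/inM Mx xy]] /out [x' [/inM Mx' xz]] Myz.
  apply: (Mab _ (MM _ _ (MM _ _ Mx Mx') Myz)); rewrite (meetA BA).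
  apply: (meet_join_le BA).
    apply: le_trans xy => //; rewrite (meetA BA a x y).
    exact: (leIxy BA (leIxy BA (le_refl BA _) (leIl BA _ _)) (le_refl BA _)).
  apply: le_trans xz => //; rewrite (meetA BA a x' z).
  exact: (leIxy BA (leIxy BA (le_refl BA _) (leIr BA _ _)) (le_refl BA _)).
- apply: contrapT => /out [x [/axb nxb]] axa; apply: nxb.
  apply: le_trans axa => //; apply: lexI => //; first exact: leIl.
  by apply: lexI => //; [apply: leIr|apply: leIl].
- by move/Mab; apply; apply: leIr.
Qed.

Lemma filter_quotient (G : set A) : brouwerian_algebra A -> lattice_filter G ->
  exists (C : algebra brouwerian_signature) (q : A -> C),
    [/\ homomorphism q, forall c, exists a, q a = c &
    forall a b, q a = q b <-> exists2 g, G g & meet g a = meet g b].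
Proof.
move=> BA /(filter_congruence BA) /quotient_exists [C [q [qh [qs qE]]]].
by exists C, q; split.
Qed.

Lemma separation a b : layered_brouwerian A -> ~ le a b ->
  exists (C : algebra brouwerian_signature) (q : A -> C),
    [/\ layered_brouwerian C, well_connected C,
    homomorphism q, q a = top C & q b <> top C].
Proof.
move=> KA; have [BA _] := KA.
move=> /(prime_separation BA) [P [[PF Pprime] Pa nPb]].
have [[p Pp] Pup PM] := PF.
have [C [q [qh qs qE]]] := filter_quotient BA PF.
have q1 x : q x = top C <-> P x.
  rewrite -(hom_top qh) qE; split=> [[g Pg e]|Px].
    by apply: Pup Pg _; move: e; rewrite meetx1.
  by exists x; rewrite // meetx1 // meetxx.
exists C, q; split=> //.
- exact: (variety_image variety_layered_brouwerian qh qs KA).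
- move=> c d; have [x <-] := qs c; have [y <-] := qs d.
  rewrite -(hom_join qh) !q1 => Pxy.
  by apply: contrapT => /not_orP [nx ny]; apply: Pprime Pxy.
- exact/q1.
- by move/q1.
Qed.

End Separation.

(** * Well-connected layered algebras *)

Section Layered.
Variable L : algebra brouwerian_signature.
Hypotheses (KL : layered_brouwerian L) (wL : well_connected L).
Implicit Types x y z u v w : L.

Let BL : brouwerian_algebra L := proj1 KL.

Definition comparable x y := le x y \/ le y x.

Lemma comparable_sym x y : comparable x y -> comparable y x.
Proof. by case; [right|left]. Qed.

Lemma mate_unique x y z : ~ comparable x y -> ~ comparable x z -> y = z.
Proof.
move=> nxy nxz; have := (proj2 KL) x y z.
case/wL=> [/(impP BL) h|]; first by case: nxy; left.
case/wL=> [/(impP BL) h|]; first by case: nxy; right.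
case/wL=> [/(impP BL) h|]; first by case: nxz; left.
case/wL=> [/(impP BL) h|h]; first by case: nxz; right.
apply: (le_anti BL); apply/(impP BL)/(top_le BL); rewrite -h; [exact: leIl|exact: leIr].
Qed.

Lemma meet_comparable x y z : ~ comparable x y -> comparable z (meet x y).
Proof.
move=> nxy; have nyx : ~ comparable y x by move/comparable_sym.
case: (pselect (comparable x z)) => [[xz|zx]|nxz].
- by right; apply: le_trans xz => //; apply: leIl.
- case: (pselect (comparable y z)) => [[yz|zy]|nyz].
  + by right; apply: le_trans yz => //; apply: leIr.
  + by left; apply: lexI.
  + by rewrite -(mate_unique nyx nyz); right; apply: leIl.
- by rewrite -(mate_unique nxy nxz); right; apply: leIr.
Qed.

Lemma join_comparable x y z : ~ comparable x y -> comparable z (join x y).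
Proof.
move=> nxy; have nyx : ~ comparable y x by move/comparable_sym.
case: (pselect (comparable x z)) => [[xz|zx]|nxz].
- case: (pselect (comparable y z)) => [[yz|zy]|nyz].
  + by right; apply: leUx.
  + by left; apply: le_trans zy _ => //; apply: leUr.
  + by rewrite -(mate_unique nyx nyz); left; apply: leUl.
- by left; apply: le_trans zx _ => //; apply: leUl.
- by rewrite -(mate_unique nxy nxz); left; apply: leUr.
Qed.

Lemma imp_cases u v : [\/ imp u v = top L, imp u v = v |
  ~ comparable u (imp u v)].
Proof.
case: (pselect (comparable u (imp u v))) => [[h|h]|]; last by constructor 3.
  constructor 1; apply/(impP BL); apply: le_trans (modus_ponens BL u v) => //.
  by apply: lexI => //; apply: le_refl.
constructor 2; apply: (le_anti BL) (le_impr BL _ _).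
apply: le_trans (modus_ponens BL u v) => //.
by apply: lexI => //; apply: le_refl.
Qed.

(** The values [l n], [r n] taken by a homomorphism on the two sides of the
    [n]-th of a sequence of four-element Boolean lattices, each hanging from the
    bottom of the preceding one. *)
Definition diamonds (l r : nat -> L) := forall n,
  [/\ imp (l n) (r n) = r n, imp (r n) (l n) = l n &
      meet (l n) (r n) = join (l n.+1) (r n.+1)].

Lemma diamond_cases l r n : diamonds l r ->
  [\/ l n = top L, r n = top L | ~ comparable (l n) (r n)].
Proof.
move=> d; have [lr rl _] := d n.
case: (pselect (comparable (l n) (r n))) => [[/(impP BL) e|/(impP BL) e]|];
  last by constructor 3.
- by constructor 2; rewrite -lr e.
- by constructor 1; rewrite -rl e.
Qed.

(** Only a diamond whose [l]-side goes to the top can have its other side sent to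
    two places.  If [l n] is not the top, its incomparable partner being unique, one
    of the two values, say [r n], is the top.  Then the top of the diamond below is
    [l n], which is incomparable with [r' n].  As joins of incomparable elements
    are comparable with everything, the sides of that diamond are comparable, so
    one of them is the top, and [l n] with it. *)
Lemma diamonds_differ l r r' n : diamonds l r -> diamonds l r' ->
  r n <> r' n -> l n = top L.
Proof.
move=> d d' ne.
suff half s s' : diamonds l s -> diamonds l s' -> s n = top L ->
    s n <> s' n -> l n = top L.
  case: (diamond_cases n d) => [//|rn|nlr]; first exact: half d d' rn ne.
  case: (diamond_cases n d') => [//|rn|nlr'].
    by apply: half d' d rn _ => e; apply: ne.
  by case: ne; apply: mate_unique nlr nlr'.
move=> {}d {}d' sn; rewrite sn => ne'.
case: (diamond_cases n d') => [//|e|nls]; first by case: ne'.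
have [_ _ lE] := d n; rewrite sn meetx1 // in lE.
have [_ _ mE] := d' n.
case: (diamond_cases n.+1 d) => [e|e|nc].
- by rewrite lE e join1x.
- by rewrite lE e (joinC BL) join1x.
- by case: nls; rewrite lE; apply/comparable_sym/join_comparable.
Qed.

(** If [r n] and [r' n] differed, [l n] would be the top, so they would be the tops
    of the two values of the next diamond.  These would then differ as well, so
    [l n.+1] would be the top, and both [r n] and [r' n] with it. *)
Lemma diamonds_unique l r r' : diamonds l r -> diamonds l r' -> r = r'.
Proof.
move=> d d'; apply/funext => n; apply: contrapT => ne.
have ln := diamonds_differ d d' ne.
have [_ _] := d n; have [_ _] := d' n; rewrite ln !meet1x // => r'E rE.
have ne1 : r n.+1 <> r' n.+1 by move=> e; apply: ne; rewrite rE r'E e.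
have ln1 := diamonds_differ d d' ne1.
by apply: ne; rewrite rE r'E ln1 !join1x.
Qed.

End Layered.

(** * Local finiteness *)

(** Adding to each of [n] elements the other side, the bottom and the top of the
    diamond in which it may be a side yields a subuniverse: an operation either
    returns the top or one of its arguments, or it stays in a diamond. *)
Lemma finite_hull (L : algebra brouwerian_signature) n (x : 'I_n -> L) :
  layered_brouwerian L -> well_connected L ->
  exists e : option ('I_n * 'I_4) -> L,
    [/\ e None = top L, forall m, e (Some (m, ord0)) = x m &
      forall i j, [/\ exists k, imp (e i) (e j) = e k,
        exists k, meet (e i) (e j) = e k & exists k, join (e i) (e j) = e k]].
Proof.
move=> KL wL; have [BL _] := KL.
have ex_mate (u : L) : exists w, ~ comparable u w \/ (w = u /\ forall v, comparable u v).
  case: (pselect (exists w, ~ comparable u w)) => [[w]|none]; first by exists w; left.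
  by exists u; right; split=> // v; apply: contrapT => nuv; apply: none; exists v.
have [mate mateP] := choice ex_mate.
pose d u (k : nat) := nth (join u (mate u)) [:: u; mate u; meet u (mate u)] k.
pose e (i : option ('I_n * 'I_4)) := if i is Some (m, k) then d (x m) k else top L.
have side i w : ~ comparable (e i) w ->
    [/\ exists k, w = e k, exists k, meet (e i) w = e k & exists k, join (e i) w = e k].
  case: i => [[m k]|] /=; last by case; right; apply: le_top.
  have dE k' (lt4 : k' < 4) : exists i, d (x m) k' = e i.
    by exists (Some (m, Ordinal lt4)).
  case: (mateP (x m)) => [nc|[mE c]].
    have nc' : ~ comparable (mate (x m)) (x m) by move/comparable_sym.
    case: k => -[|[|[|[|]]]] //= lt4; rewrite /d /= => nw.
    - by rewrite -(mate_unique KL wL nc nw); split; [exact: (dE 1)|exact: (dE 2)|exact: (dE 3)].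
    - rewrite -(mate_unique KL wL nc' nw) (meetC BL) (joinC BL).
      by split; [exact: (dE 0)|exact: (dE 2)|exact: (dE 3)].
    - by case: nw; apply/comparable_sym/(meet_comparable KL wL).
    - by case: nw; apply/comparable_sym/(join_comparable KL wL).
  suff -> : d (x m) k = x m by case/(_ (c w)).
  by rewrite /d mE (meetxx BL) (joinxx BL); case: k => -[|[|[|[|]]]].
exists e; split=> // i j; split.
- case: (imp_cases KL (e i) (e j)) => [->|->|/side[] //]; first by exists None.
  by exists j.
- case: (pselect (comparable (e i) (e j))) => [[ij|ji]|/side[] //].
    by exists i.
  by exists j; rewrite (meetC BL).
- case: (pselect (comparable (e i) (e j))) => [[ij|ji]|/side[] //].
    by exists j; apply: join_r.
  by exists i; rewrite (joinC BL); apply: join_r.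
Qed.

(** The well-connected quotients of an algebra generated by [n] elements are all
    described, up to equality of their kernels, by tables of a fixed finite size:
    the operations on the hull of the generators and the indices of its top.  An
    element is determined by the tables of the quotients that send it to the
    top. *)
Lemma locally_finite_layered_brouwerian : locally_finite layered_brouwerian.
Proof.
move=> A KA [X finX genX]; have [BA _] := KA.
have [n [x Xx]] : exists n (x : 'I_n -> A), X `<=` range x.
  have [s Xs] := (finite_seqP (X : set {classic A})).1 finX.
  exists (size s), (tnth (in_tuple s)) => a; rewrite Xs /= => /seq_tnthP[i ->].
  by exists i.
pose I : finType := option ('I_n * 'I_4).
pose data : finType := ({ffun I * I * I -> bool * bool * bool} * {ffun I -> bool})%type.
pose presents (D : data) (C : algebra brouwerian_signature) (q : A -> C) :=
  exists e : I -> C,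
  [/\ homomorphism q /\ e None = top C, forall m, e (Some (m, ord0)) = q (x m),
    forall i j, [/\ exists k, imp (e i) (e j) = e k,
        exists k, meet (e i) (e j) = e k & exists k, join (e i) (e j) = e k],
    forall i j k, D.1 (i, j, k) = (`[< imp (e i) (e j) = e k >],
      `[< meet (e i) (e j) = e k >], `[< join (e i) (e j) = e k >]) &
    forall i, D.2 i = `[< e i = top C >]].
have data_top D C C' q q' a : @presents D C q -> @presents D C' q' ->
    q a = top C -> q' a = top C'.
  move=> [e [[qh e1] eX eop eD eT]] [e' [[qh' e1'] eX' _ eD' eT']].
  have [i [-> -> ei]] : exists i, [/\ q a = e i, q' a = e' i & True].
    move: a; apply: (generated_ind genX); last first.
      by move=> _ /Xx[m _ <-]; exists (Some (m, ord0)).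
    apply: build_subuniverse.
    - move=> a b [i [ai ai' _]] [j [bj bj' _]]; have [[k ijk] _ _] := eop i j.
      exists k; rewrite (hom_imp qh) (hom_imp qh') ai ai' bj bj'; split=> //.
      have := eD i j k; rewrite eD' => -[+ _ _].
      by rewrite (asboolT ijk) => /asboolP.
    - move=> a b [i [ai ai' _]] [j [bj bj' _]]; have [_ [k ijk] _] := eop i j.
      exists k; rewrite (hom_meet qh) (hom_meet qh') ai ai' bj bj'; split=> //.
      have := eD i j k; rewrite eD' => -[_ + _].
      by rewrite (asboolT ijk) => /asboolP.
    - move=> a b [i [ai ai' _]] [j [bj bj' _]]; have [_ _ [k ijk]] := eop i j.
      exists k; rewrite (hom_join qh) (hom_join qh') ai ai' bj bj'; split=> //.
      have := eD i j k; rewrite eD' => -[_ _ +].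
      by rewrite (asboolT ijk) => /asboolP.
    - by exists None; rewrite (hom_top qh) (hom_top qh').
  by move=> /asboolP; rewrite -eT eT' => /asboolP.
have data_exists (C : algebra brouwerian_signature) (q : A -> C) :
    homomorphism q -> layered_brouwerian C ->
    well_connected C -> exists D, presents D C q.
  move=> qh KC wC; have [e [e1 eX eop]] := finite_hull (q \o x) KC wC.
  exists ([ffun t => (`[< imp (e t.1.1) (e t.1.2) = e t.2 >],
      `[< meet (e t.1.1) (e t.1.2) = e t.2 >], `[< join (e t.1.1) (e t.1.2) = e t.2 >])],
    [ffun i => `[< e i = top C >]]).
  by exists e; split=> // [i j k|i]; rewrite ffunE.
pose F (a : A) : {set data} :=
  [set D | `[< exists (C : algebra brouwerian_signature) (q : A -> C),
    presents D C q /\ q a = top C >]]%SET.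
have F_le a b : F a = F b -> le a b.
  move=> Fab; apply: contrapT => /(separation KA) [C [q [KC wC qh qa qb]]].
  have [D Dq] := data_exists C q qh KC wC.
  have : D \in F a by rewrite inE; apply/asboolP; exists C, q.
  rewrite Fab inE => /asboolP[C' [q' [Dq' q'b]]].
  by apply: qb; apply: data_top Dq' Dq q'b.
rewrite -(preimage_setT F); apply: finite_preimage; last exact: finite_finset.
by move=> a b _ _ Fab; apply: (le_anti BA); apply: F_le.
Qed.

(** * The weak ES property *)

(** Let [G] be the filter generated by the elements of [Y] above [b], and let [f]
    be the quotient map to [B / G].  Modulo the filter of [b] every element of
    [B] is equal to an element of [Y], because [b] itself is equal to the top; as
    [G] and the filter of [b] contain the same elements of [Y], this gives a
    second map [g] from [B] to [B / G], which agrees with [f] on [Y] but sends [b]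
    to the top.  This is Kreisel's explicit definition of a variable by
    substitution of the top for it, in algebraic form. *)
Lemma proper_almost_onto_not_epi (B : algebra brouwerian_signature) (Y : set B) b :
  brouwerian_algebra B -> subuniverse Y -> generated (Y `|` [set b]) = [set: B] ->
  ~ Y b ->
  exists (C : algebra brouwerian_signature) (f g : B -> C),
    [/\ homomorphism f, homomorphism g, forall c, exists x, f x = c,
      forall a, Y a -> f a = g a & f b <> g b].
Proof.
move=> BB sY genY nYb.
have YI x y : Y x -> Y y -> Y (imp x y).
  by move=> Yx Yy; apply: (sY Imp) => i; rewrite /args2; case: ifP.
have YM x y : Y x -> Y y -> Y (meet x y).
  by move=> Yx Yy; apply: (sY Meet) => i; rewrite /args2; case: ifP.
have YJ x y : Y x -> Y y -> Y (join x y).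
  by move=> Yx Yy; apply: (sY Join) => i; rewrite /args2; case: ifP.
have Y1 : Y (top B) by apply: (sY Top) => -[].
pose G := [set z | exists a, [/\ Y a, le b a & le a z]].
have GF : lattice_filter G.
  split.
  - by exists (top B), (top B); split=> //; [apply: le_top|apply: le_refl].
  - by move=> x y [a [Ya ba ax]] xy; exists a; split=> //; apply: le_trans xy.
  - move=> x y [a [Ya ba ax]] [a' [Ya' ba' ay]]; exists (meet a a').
    by split; [apply: YM|apply: lexI|apply: leIxy].
have [C [f [fh fs fE]]] := filter_quotient BB GF.
have dense (z : B) : exists a, Y a /\ meet b a = meet b z.
  move: z; apply: (generated_ind genY); last first.
    move=> z [Yz|->]; first by exists z.
    by exists (top B); rewrite meetx1 // meetxx.
  apply: build_subuniverse; last by exists (top B).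
  - move=> x y [a [Ya ax]] [a' [Ya' ay]]; exists (imp a a').
    by split; [apply: YI|apply: meet_imp_cong].
  - move=> x y [a [Ya ax]] [a' [Ya' ay]]; exists (meet a a').
    by split; [apply: YM|apply: meet_meet_cong].
  - move=> x y [a [Ya ax]] [a' [Ya' ay]]; exists (join a a').
    by split; [apply: YJ|apply: meet_join_cong].
have [r rP] := choice dense.
have rY z : Y (r z) by have [] := rP z.
have rb z : meet b (r z) = meet b z by have [] := rP z.
have f_eq a a' : Y a -> Y a' -> meet b a = meet b a' -> f a = f a'.
  move=> Ya Ya' e; apply/fE.
  have b_imp u v : meet b u = meet b v -> le b (imp u v).
    by move=> uv; apply: le_impI => //; rewrite uv; apply: leIr.
  exists (meet (imp a a') (imp a' a)).
    exists (meet (imp a a') (imp a' a)).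
    by split; [apply: YM; apply: YI|apply: lexI => //; apply: b_imp|apply: le_refl].
  apply: (le_anti BB); apply: (lexI BB (leIl BB _ _)).
    exact: (le_trans BB (leIxy BB (leIl BB _ _) (le_refl BB a)) (modus_ponens BB a a')).
  exact: (le_trans BB (leIxy BB (leIr BB _ _) (le_refl BB a')) (modus_ponens BB a' a)).
exists C, f, (f \o r); split=> //.
- apply: build_hom => /=.
  + move=> x y; rewrite -(hom_imp fh); apply: f_eq; rewrite ?rb //; first exact: YI.
    by apply: meet_imp_cong.
  + move=> x y; rewrite -(hom_meet fh); apply: f_eq; rewrite ?rb //; first exact: YM.
    by apply: meet_meet_cong.
  + move=> x y; rewrite -(hom_join fh); apply: f_eq; rewrite ?rb //; first exact: YJ.
    by apply: meet_join_cong.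
  + by rewrite -(hom_top fh); apply: f_eq.
- by move=> a Ya /=; apply: f_eq.
(* If [f b = f (r b)], where [r b] lies above [b] in [Y], some [a] in [Y] above
   [b] has [a /\ r b <= b], which puts [b] in [Y]. *)
- move=> /= /fE[g [a [Ya ba ag]] e]; apply: nYb.
  suff -> : b = meet a (r b) by apply: YM.
  apply: (le_anti BB).
    by apply: lexI => //; rewrite /le rb meetxx.
  apply: (le_trans BB (leIxy BB ag (le_refl BB (r b)))).
  by rewrite -e; apply: leIr.
Qed.

Lemma weak_ES_layered_brouwerian : weak_ES_property layered_brouwerian.
Proof.
move=> A B h KA KB hh [b genB] epi; apply: (almost_onto_range hh genB).
apply: contrapT => nb.
have [C [f [g [fh gh fs fg fb]]]] :=
  proper_almost_onto_not_epi (proj1 KB) (range_subuniverse hh) genB nb.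
apply: fb; congr (_ b); apply: epi => //.
  exact: (variety_image variety_layered_brouwerian fh fs KB).
by apply/funext => x /=; apply: fg; exists x.
Qed.

(** * Width *)

Section SubdirectIrreducibility.
Variable A : algebra brouwerian_signature.
Hypothesis BA : brouwerian_algebra A.

(** If [u] and [v] join to the top, the congruences of their principal filters
    intersect in the identity. *)
Lemma fsi_well_connected : finitely_subdirectly_irreducible A -> well_connected A.
Proof.
move=> fsi u v uv1.
pose th (w : A) := [set p : A * A | exists2 g, le w g & meet g p.1 = meet g p.2].
have thC w : congruence (th w) := filter_congruence BA (principal_filter w BA).
have thE w p : th w p -> meet w p.1 = meet w p.2.
  by move=> [g wg e]; rewrite -wg -!(meetA BA) e.
have th1 w : th w = diagonal -> w = top A.
  move=> e; have : th w (w, top A).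
    by exists w; [apply: le_refl|rewrite /= meetx1 // meetxx].
  by rewrite e.
have [|/th1|/th1] := fsi _ _ (thC u) (thC v); [|by left|by right].
apply/seteqP; split=> [[x y] /= [/thE /= xyu /thE /= xyv]|[x y] /= xy]; last first.
  have xy' : x = y := xy.
  by rewrite xy'; split; exists (top A) => //; apply: le_top.
have half a b : meet u a = meet u b -> meet v a = meet v b -> le a b.
  move=> ua va; rewrite -(meetx1 BA a) -uv1; apply: meet_join_le => //.
    by rewrite (meetC BA) ua; apply: leIr.
  by rewrite (meetC BA) va; apply: leIr.
by apply: (le_anti BA); apply: half.
Qed.

Lemma well_connected_fsi : well_connected A -> finitely_subdirectly_irreducible A.
Proof.
move=> wA th1 th2 C1 C2 e.
(* A congruence that is not the identity identifies some [u <> top] with [top]. *)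
have above (th : set (A * A)) : congruence th -> th <> diagonal ->
    exists u, u <> top A /\ forall v, th (join u v, top A).
  move=> [Rf Sy Tr Op] nd; apply: contrapT => none; apply: nd.
  have cI (x y x' y' : A) : th (x, x') -> th (y, y') -> th (imp x y, imp x' y').
    by move=> xx yy; apply: (Op Imp) => i; rewrite /args2; case: ifP.
  have cM (x y x' y' : A) : th (x, x') -> th (y, y') -> th (meet x y, meet x' y').
    by move=> xx yy; apply: (Op Meet) => i; rewrite /args2; case: ifP.
  have cJ (x y x' y' : A) : th (x, x') -> th (y, y') -> th (join x y, join x' y').
    by move=> xx yy; apply: (Op Join) => i; rewrite /args2; case: ifP.
  apply/seteqP; split=> [[x y] xy|[x y] /= exy]; last first.
    have exy' : x = y := exy.
    by rewrite exy'.
  have ixx z : imp z z = top A by apply/(impP BA)/le_refl.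
  apply: contrapT => nxy; apply: none; exists (meet (imp x y) (imp y x)); split.
    move=> h; apply: nxy; rewrite /diagonal /=.
    by apply: (le_anti BA); apply/(impP BA)/(top_le BA); rewrite -h; [apply: leIl|apply: leIr].
  move=> v; have /cJ/(_ (Rf v)) : th (meet (imp x y) (imp y x), meet (imp y y) (imp y y)).
    by apply: cM; apply: cI => //; apply: Rf.
  by rewrite ixx meetx1 // join1x.
case: (pselect (th1 = diagonal)) => [|n1]; first by left.
case: (pselect (th2 = diagonal)) => [|n2]; first by right.
have [u [nu uP]] := above _ C1 n1; have [v [nv vP]] := above _ C2 n2.
have : (th1 `&` th2) (join u v, top A).
  by split; [apply: uP|rewrite (joinC BA); apply: vP].
by rewrite e /diagonal /= => /wA[].
Qed.

End SubdirectIrreducibility.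

Lemma card_le2 T (X : set T) :
  (forall x y z, X x -> X y -> X z -> [\/ x = y, x = z | y = z]) -> X #<= `I_2.
Proof.
move=> X3; case: (pselect (exists x y, [/\ X x, X y & x <> y])) => [[x [y [Xx Xy xy]]]|none].
  have : X `<=` (fun n => if n == 0 then x else y) @` `I_2.
    by move=> z /(X3 x y z Xx Xy)[//|<-|<-]; [exists 0|exists 1].
  by move/subset_card_le => h; apply: card_le_trans h (card_image_le _ _).
case: (pselect (exists x, X x)) => [[x Xx]|nX].
  have : X `<=` (fun=> x) @` `I_2.
    move=> z Xz; exists 0 => //; apply: contrapT => xz.
    by apply: none; exists x, z.
  by move/subset_card_le => h; apply: card_le_trans h (card_image_le _ _).
have -> : X = set0 by apply/seteqP; split=> // z Xz; apply: nX; exists z.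
exact: card_ge0.
Qed.

Lemma card_ge2 T (x y : T) : x <> y -> `I_2 #<= [set x; y].
Proof.
move=> xy; have : `I_2 `<=` (fun z => if `[< z = x >] then 0 else 1) @` [set x; y].
  move=> [|[|//]] _; first by exists x; [left|rewrite asboolT].
  by exists y; [right|rewrite asboolF // => yx; apply: xy].
by move/subset_card_le => h; apply: card_le_trans h (card_image_le _ _).
Qed.

(** Each of three pairwise incomparable prime filters has an element outside the
    other two; such elements are pairwise incomparable. *)
Lemma prime_antichain (A : algebra brouwerian_signature) (X : set (set A)) :
  layered_brouwerian A -> well_connected A -> X `<=` @prime_filter A ->
  antichain X -> X #<= `I_2.
Proof.
move=> KA wA XP acX; apply: card_le2 => P Q R XX XQ XR.
case: (pselect (P = Q)) => [|PQ]; first by constructor 1.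
case: (pselect (P = R)) => [|PR]; first by constructor 2.
case: (pselect (Q = R)) => [|QR]; [by constructor 3|exfalso].
have pick F G H : X F -> X G -> X H -> F <> G -> F <> H ->
    exists a, [/\ F a, ~ G a & ~ H a].
  move=> XF XG XH FG FH.
  have nsub E : X E -> F <> E -> exists a, F a /\ ~ E a.
    move=> XE FE; apply: contrapT => none; apply: FE; apply: acX => // a Fa.
    by apply: contrapT => nEa; apply: none; exists a.
  have [[[_ Fup FM] _] [[_ Gup _] _] [[_ Hup _] _]] := And3 (XP _ XF) (XP _ XG) (XP _ XH).
  have [a [Fa nGa]] := nsub _ XG FG; have [b [Fb nHb]] := nsub _ XH FH.
  exists (meet a b); split; first exact: FM.
    by move=> Gab; apply: nGa; apply: Gup Gab _; apply: leIl (proj1 KA) _ _.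
  by move=> Hab; apply: nHb; apply: Hup Hab _; apply: leIr (proj1 KA) _ _.
have sym T (x y : T) : x <> y -> y <> x by move=> xy yx; apply: xy.
have [p [Pp nQp nRp]] := pick P Q R XX XQ XR PQ PR.
have [q [Qq nPq nRq]] := pick Q P R XQ XX XR (sym _ _ _ PQ) QR.
have [r [Rr nPr nQr]] := pick R P Q XR XX XQ (sym _ _ _ PR) (sym _ _ _ QR).
have inc F G a b : X F -> X G -> F a -> ~ F b -> G b -> ~ G a -> ~ comparable a b.
  move=> /XP[[_ Fup _] _] /XP[[_ Gup _] _] Fa nFb Gb nGa [ab|ba].
    by apply: nFb; apply: Fup ab.
  by apply: nGa; apply: Gup ba.
have qr : q = r by apply: (mate_unique KA wA (x := p)); [apply: (inc P Q)|apply: (inc P R)].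
by apply: nRq; rewrite qr.
Qed.

(** * Algebras of up-sets *)

Section UpSets.
Variables (T : Type) (r : T -> T -> Prop).

Definition up_closed (U : set T) := forall x y, U x -> r x y -> U y.

Definition upset := {U : set T | up_closed U}.

Definition upset_in (U : upset) (x : T) : Prop := sval U x.
Local Coercion upset_in : upset >-> Funclass.

Lemma upset_up (U : upset) x y : U x -> r x y -> U y.
Proof. exact: (proj2_sig U). Qed.

Lemma upset_eq (U V : upset) : (forall x, U x <-> V x) -> U = V.
Proof.
case: U V => U UP [V VP] UV; apply: eq_exist; apply/seteqP.
by split=> x; [exact: (UV x).1|exact: (UV x).2].
Qed.

Hypotheses (rr : forall x, r x x) (rt : forall x y z, r x y -> r y z -> r x z).

Lemma up_imp_subproof (U V : upset) :
  up_closed [set x | forall y, r x y -> U y -> V y].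
Proof. by move=> x y UV xy z yz; apply: UV; apply: rt yz. Qed.

Lemma up_meet_subproof (U V : upset) : up_closed [set x | U x /\ V x].
Proof. by move=> x y [Ux Vx] xy; split; [apply: upset_up Ux xy|apply: upset_up Vx xy]. Qed.

Lemma up_join_subproof (U V : upset) : up_closed [set x | U x \/ V x].
Proof.
by move=> x y [Ux|Vx] xy; [left; apply: upset_up Ux xy|right; apply: upset_up Vx xy].
Qed.

Definition up_imp U V : upset := exist _ _ (@up_imp_subproof U V).
Definition up_meet U V : upset := exist _ _ (@up_meet_subproof U V).
Definition up_join U V : upset := exist _ _ (@up_join_subproof U V).
Definition up_top : upset := exist up_closed [set: T] (fun _ _ _ _ => I).
Definition up_bot : upset := exist up_closed set0 (fun _ _ Ux _ => Ux).

Definition up_algebra : algebra heyting_signature :=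
  @Algebra heyting_signature upset (fun f =>
    match f return ('I_(heyting_arity f) -> upset) -> upset with
    | Brouwerian Imp => fun U : 'I_2 -> upset => up_imp (U ord0) (U ord_max)
    | Brouwerian Meet => fun U : 'I_2 -> upset => up_meet (U ord0) (U ord_max)
    | Brouwerian Join => fun U : 'I_2 -> upset => up_join (U ord0) (U ord_max)
    | Brouwerian Top => fun=> up_top
    | Bot => fun=> up_bot
    end).

Local Notation Up := (brouwerian_reduct up_algebra).

Lemma up_leP (U V : Up) : le U V <-> forall x, (U : upset) x -> (V : upset) x.
Proof.
split=> [UV x Ux|UV]; last by apply: upset_eq => x; split=> [[]//|Ux]; split=> //; apply: UV.
have : (meet U V : upset) x by rewrite UV.
by case.
Qed.

Lemma up_heyting : heyting_algebra up_algebra.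
Proof.
split; last by move=> U; apply/up_leP.
split.
- by move=> U V; apply: upset_eq => x; split=> -[].
- by move=> U V W; apply: upset_eq => x; split=> [[Ux [Vx Wx]]|[[Ux Vx] Wx]].
- by move=> U V; apply: upset_eq => x; split=> -[]; by [left|right].
- by move=> U V W; apply: upset_eq => x; split;
    [move=> [|[]]|move=> [[]|]]; rewrite /= /upset_in /=; tauto.
- by move=> U V; apply: upset_eq => x; split=> [[]//|Ux]; split=> //; left.
- by move=> U V; apply: upset_eq => x; split=> [[//|[]//]|Ux]; left.
- by move=> U; apply/up_leP.
- move=> U V W; split=> /up_leP UVW; apply/up_leP => x.
    by move=> Ux y xy Vy; apply: UVW; split=> //; apply: upset_up Ux xy.
  by move=> [Ux Vx]; apply: UVW Ux _ (rr x) Vx.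
Qed.

(** When every point is incomparable with at most one other point, an up-set
    with an element and a non-element that are incomparable is determined by
    this pair, which is thus shared by any two up-sets incomparable with a third
    one. *)
Lemma layered_upsets (U V W : upset) p q s t :
  (forall x y z, ~ (r x y \/ r y x) -> ~ (r x z \/ r z x) -> y = z) ->
  U p -> ~ V p -> V q -> ~ U q -> U s -> ~ W s -> W t -> ~ U t ->
  forall x, V x -> W x.
Proof.
move=> mate Up_ nVp Vq nUq Us nWs Wt nUt x Vx.
have inc (F G : upset) a b : F a -> ~ G a -> G b -> ~ F b -> ~ (r a b \/ r b a).
  move=> Fa nGa Gb nFb [ab|ba]; first by apply: nFb; apply: upset_up Fa ab.
  by apply: nGa; apply: upset_up Gb ba.
have sym a b : ~ (r a b \/ r b a) -> ~ (r b a \/ r a b) by tauto.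
have pq := inc U V p q Up_ nVp Vq nUq; have st := inc U W s t Us nWs Wt nUt.
have ps : p = s.
  apply: contrapT => nps.
  case: (pselect (r p s \/ r s p)) => [[ps|sp]|nc].
  - case: (pselect (r t p \/ r p t)) => [[tp|pt]|nc].
    + by apply: st; right; apply: rt ps.
    + by apply: nUt; apply: upset_up Up_ pt.
    + by apply: nps; apply: (mate t); [move=> h; apply: nc; tauto|apply: sym].
  - case: (pselect (r q s \/ r s q)) => [[qs|sq]|nc].
    + by apply: pq; right; apply: rt sp.
    + by apply: nUq; apply: upset_up Us sq.
    + by apply: nps; apply: (mate q); [apply: sym|].
  - by apply: nUq; rewrite (mate p q s pq nc).
have qt : q = t by apply: (mate p) => //; rewrite ps.
case: (pselect (r p x \/ r x p)) => [[px|xp]|nc]; last by rewrite -(mate p q x pq nc) qt.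
  case: (pselect (r q x \/ r x q)) => [[qx|xq]|nc].
  - by rewrite qt in qx; apply: upset_up Wt qx.
  - by case: pq; left; apply: rt xq.
  - by case: nVp; rewrite (mate q p x (sym _ _ pq) nc).
by case: nVp; apply: upset_up Vx xp.
Qed.

Lemma up_layered :
  (forall x y z, ~ (r x y \/ r y x) -> ~ (r x z \/ r z x) -> y = z) ->
  layered_brouwerian Up.
Proof.
move=> mate; split; first by have [] := up_heyting.
move=> U V W; apply: upset_eq => x; split=> // _.
have wit (F G : Up) : ~ (imp F G : upset) x ->
    exists y, [/\ r x y, (F : upset) y & ~ (G : upset) y].
  move=> nFG; apply: contrapT => none; apply: nFG => y xy Fy.
  by apply: contrapT => nGy; apply: none; exists y.
apply: contrapT => /not_orP[/wit[p [_ Up_ nVp]]].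
move=> /not_orP[/wit[q [_ Vq nUq]]] /not_orP[/wit[s [_ Us nWs]]].
move=> /not_orP[/wit[t [_ Wt nUt]]]; apply; split=> y _.
  exact: (layered_upsets mate Up_ nVp Vq nUq Us nWs Wt nUt).
exact: (layered_upsets mate Us nWs Wt nUt Up_ nVp Vq nUq).
Qed.

(** Only the full up-set contains a root. *)
Lemma up_well_connected o : (forall x, r o x) -> well_connected Up.
Proof.
move=> ro U V UV; have : (join U V : upset) o by rewrite UV.
by case=> Uo; [left|right]; apply: upset_eq => x; split=> // _; apply: upset_up Uo (ro x).
Qed.

Definition points_filter x : set up_algebra := [set U : upset | U x].

Lemma points_filter_dual x : heyting_dual (points_filter x).
Proof.
split; last first.
  by move=> e; have : points_filter x up_bot by rewrite e.
split; last by move=> U V nU nV [].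
split; first by exists up_top.
- by move=> U V Ux /up_leP; apply.
- by move=> U V Ux Vx; split.
Qed.

End UpSets.

(** * Inverse images along p-morphisms *)

Section InverseImage.
Variables (T T' : Type) (r : T -> T -> Prop) (r' : T' -> T' -> Prop).
Hypotheses (rt : forall x y z, r x y -> r y z -> r x z)
  (rt' : forall x y z, r' x y -> r' y z -> r' x z).
Variable pi : T -> T'.
Hypotheses (pi_mono : forall x y, r x y -> r' (pi x) (pi y))
  (pi_lift : forall x z, r' (pi x) z -> exists y, r x y /\ pi y = z).

Lemma inverse_image_subproof (U : upset r') : up_closed r [set x | upset_in U (pi x)].
Proof. by move=> x y Ux xy; apply: upset_up Ux (pi_mono xy). Qed.

Definition inverse_image (U : upset r') : upset r :=
  exist _ _ (@inverse_image_subproof U).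

Lemma inverse_image_hom :
  @homomorphism heyting_signature (up_algebra rt') (up_algebra rt) inverse_image.
Proof.
case=> [[]|] args; apply: upset_eq => x //; split=> H.
- by move=> y xy Uy; apply: (H (pi y)) => //; apply: pi_mono.
- by move=> z /pi_lift[y [xy <-]] Uy; apply: (H y).
Qed.

End InverseImage.

(** * A non-surjective epimorphism *)

Definition chain_le (m n : nat) : Prop := m <= n.

(** The order of the linear sum of a root and of infinitely many two-element
    antichains, which makes the algebra of up-sets a sum of diamonds. *)
Definition tower_le (x y : option (nat * bool)) : Prop :=
  match x, y with
  | None, _ => True
  | Some _, None => False
  | Some (n, b), Some (m, c) => (n < m) || ((n == m) && (b == c))
  end.

Lemma chain_trans x y z : chain_le x y -> chain_le y z -> chain_le x z.
Proof. exact: leq_trans. Qed.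

Lemma tower_refl x : tower_le x x.
Proof. by case: x => [[n b]|] //=; rewrite !eqxx orbT. Qed.

Lemma tower_trans x y z : tower_le x y -> tower_le y z -> tower_le x z.
Proof.
case: x y z => [[n b]|] [[m c]|] [[k d]|] //=.
move=> /orP[nm|/andP[/eqP-> /eqP->]] // /orP[mk|/andP[/eqP<- _]].
  by rewrite (ltn_trans nm mk).
by rewrite nm.
Qed.

Lemma chain_mate x y z : ~ (chain_le x y \/ chain_le y x) ->
  ~ (chain_le x z \/ chain_le z x) -> y = z.
Proof. by case; rewrite /chain_le; case: (leqP x y) => [|/ltnW]; [left|right]. Qed.

Lemma tower_mate x y z : ~ (tower_le x y \/ tower_le y x) ->
  ~ (tower_le x z \/ tower_le z x) -> y = z.
Proof.
have mate n b w : ~ (tower_le (Some (n, b)) w \/ tower_le w (Some (n, b))) ->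
    w = Some (n, ~~ b).
  case: w => [[m c]|] /= h; last by case: h; right.
  case: (ltngtP n m) h => [nm|mn|<-] h; [by case: h; left|by case: h; right|].
  by congr (Some (_, _)); case: b c h => [] [] // []; left.
case: x => [[n b]|] h h'; last by case: h; left.
by rewrite (mate n b y h) (mate n b z h').
Qed.

Definition chain_algebra := up_algebra chain_trans.
Definition tower_algebra := up_algebra tower_trans.

Definition cone (p : option (nat * bool)) : brouwerian_reduct tower_algebra :=
  exist (up_closed tower_le) [set x | tower_le p x] (fun x y => @tower_trans p x y).

(** Gluing the two points of a layer would not give an epimorphism, because the
    algebra has an automorphism that exchanges them.  Here every fibre meets two
    consecutive layers, or the root and the first one. *)
Definition zigzag (x : option (nat * bool)) : nat :=
  match x with None => 0 | Some (n, b) => n + b end.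

Lemma zigzag_mono x y : tower_le x y -> chain_le (zigzag x) (zigzag y).
Proof.
case: x y => [[n b]|] [[m c]|] //=.
move=> /orP[nm|/andP[/eqP-> /eqP->]]; rewrite /chain_le //.
by apply: leq_trans (leq_addr _ _); apply: leq_trans nm; rewrite -addn1 leq_add2l; case: b.
Qed.

Lemma zigzag_lift x z : chain_le (zigzag x) z -> exists y, tower_le x y /\ zigzag y = z.
Proof.
rewrite /chain_le leq_eqVlt => /orP[/eqP<-|xz].
  by exists x; split=> //; apply: tower_refl.
exists (Some (z, false)); rewrite /= addn0; split=> //.
case: x xz => [[n b]|] //= nz.
by rewrite (leq_ltn_trans (leq_addr _ _) nz).
Qed.

Definition chain_to_tower : chain_algebra -> tower_algebra :=
  inverse_image zigzag_mono.

Lemma chain_to_tower_hom : homomorphism chain_to_tower.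
Proof. apply: inverse_image_hom; exact: zigzag_lift. Qed.

Lemma chain_to_tower_proper : range chain_to_tower <> [set: tower_algebra].
Proof.
move=> e; have : range chain_to_tower (cone (Some (0, false))) by rewrite e.
move=> [U _ UE].
have : upset_in (cone (Some (0, false))) (Some (0, false)) by [].
rewrite -UE => U0.
have : upset_in (chain_to_tower U) None by [].
by rewrite UE.
Qed.

Lemma cone_true_range n : cone (Some (n, true)) =
  chain_to_tower (exist (up_closed chain_le) [set k | chain_le n.+1 k]
    (fun x y => @chain_trans n.+1 x y)).
Proof.
apply: upset_eq => -[[m [] ]|] //; rewrite /upset_in /= /chain_le.
  by rewrite addn1 ltnS (leq_eqVlt n m) eqxx andbT orbC; split.
by rewrite addn0 andbF orbF; split.
Qed.

Lemma imp_cone n b :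
  imp (cone (Some (n, b))) (cone (Some (n, ~~ b))) = cone (Some (n, ~~ b)).
Proof.
have nmate : ~ tower_le (Some (n, ~~ b)) (Some (n, b)).
  by rewrite /= ltnn eqxx; case: (b).
apply: upset_eq => x; split=> [H|nx]; last first.
  by move=> y xy _; apply: tower_trans xy.
case: (pselect (tower_le x (Some (n, b)))) => [xn|nxn].
  by case: nmate; apply: (H _ xn); apply: tower_refl.
case: (pselect (tower_le (Some (n, b)) x)) => [nx|nnx].
  by apply: (H x) => //; apply: tower_refl.
have nxb : ~ (tower_le (Some (n, b)) x \/ tower_le x (Some (n, b))) by case.
have -> : x = Some (n, ~~ b); last exact: tower_refl.
apply: tower_mate nxb _ => -[]; last exact: nmate.
by rewrite /= ltnn eqxx; case: (b).
Qed.

(** In the algebra of up-sets of the tower each layer yields a diamond, with the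
    two principal up-sets of the layer as its sides. *)
Lemma cone_diamonds (L : algebra brouwerian_signature)
    (f : brouwerian_reduct tower_algebra -> L) : homomorphism f ->
  diamonds (fun n => f (cone (Some (n, true)))) (fun n => f (cone (Some (n, false)))).
Proof.
move=> fh n; split.
- by rewrite -(hom_imp fh); congr f; apply: (imp_cone n true).
- by rewrite -(hom_imp fh); congr f; apply: (imp_cone n false).
- rewrite -(hom_meet fh) -(hom_join fh); congr f; apply: upset_eq => -[[m c]|].
    rewrite /upset_in /=; split.
      move=> [h1 h2]; have nm : n < m by case: c h1 h2; rewrite ?andbF ?orbF.
      move: nm; rewrite leq_eqVlt => /orP[/eqP<-|nm]; last by left; rewrite nm.
      by rewrite eqxx; case: c {h1 h2}; [left|right]; rewrite orbT.
    have lt k : (n.+1 < m) || ((n.+1 == m) && k) -> n < m.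
      by case/orP=> [/ltnW//|/andP[/eqP<-]].
    by move=> [/lt ->|/lt ->].
  by split; [case|case].
Qed.

Lemma upset_tower_cases (U : brouwerian_reduct tower_algebra) :
  [\/ exists V, U = chain_to_tower V, exists p, U = cone p |
    exists n, U = join (cone (Some (n, true))) (cone (Some (n, false)))].
Proof.
case: (pselect (upset_in U None)) => [U0|nU0].
  constructor 1; exists (up_top chain_le); apply: upset_eq => x; split=> // _.
  exact: upset_up U0 _.
case: (pselect (exists n, `[< exists b, upset_in U (Some (n, b)) >])) => [ex|none]; last first.
  constructor 1; exists (up_bot chain_le); apply: upset_eq => -[[n b]|]; split=> //.
  by move=> Unb; case: none; exists n; apply/asboolP; exists b.
case: (ex_minnP ex) => n /asboolP[b Unb] nmin {ex}.
have above x : upset_in U x -> tower_le (Some (n, b)) x \/ x = Some (n, ~~ b).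
  case: x => [[m c]|] // Umc; have : n <= m by apply: nmin; apply/asboolP; exists c.
  rewrite leq_eqVlt => /orP[/eqP nm|nm]; last by left; rewrite /= nm.
  subst m; case: (eqVneq b c) => [<-|]; first by left; apply: tower_refl.
  by case: b c {Unb Umc} => [] [] // _; right.
case: (pselect (upset_in U (Some (n, ~~ b)))) => [Unb'|nUnb'].
  constructor 3; exists n.
  have joinU : join (cone (Some (n, b))) (cone (Some (n, ~~ b))) = U.
    apply: upset_eq => x; split=> [[nx|nx]|/above[nx|->]].
    - exact: upset_up Unb nx.
    - exact: upset_up Unb' nx.
    - by left.
    - by right; apply: tower_refl.
  rewrite -joinU; case: b {Unb above Unb' joinU} => //=.
  by apply: upset_eq => x; split=> -[]; by [left|right].
constructor 2; exists (Some (n, b)); apply: upset_eq => x; split=> [Ux|nx].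
  by case: (above x Ux) => // xE; case: nUnb'; rewrite -xE.
exact: upset_up Unb nx.
Qed.

(** The image of the chain contains one side of each diamond, the bottom and the
    top of the algebra, so only the other sides are to be recovered. *)
Lemma chain_to_tower_epi :
  @epimorphism brouwerian_signature layered_brouwerian
    (brouwerian_reduct chain_algebra) (brouwerian_reduct tower_algebra) chain_to_tower.
Proof.
move=> C KC f g fh gh fg; have [BC _] := KC.
(* [C] may be taken well-connected, since its well-connected quotients separate
   its elements. *)
have agree (L : algebra brouwerian_signature) (q : C -> L) U :
    layered_brouwerian L -> well_connected L ->
    homomorphism q -> q (f U) = q (g U).
  move=> KL wL qh.
  have qfg V : q (f (chain_to_tower V)) = q (g (chain_to_tower V)).
    by congr q; have := congr1 (fun k => k V) fg.
  have true_eq : (fun n => q (f (cone (Some (n, true))))) =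
      (fun n => q (g (cone (Some (n, true))))).
    by apply/funext => n; rewrite cone_true_range qfg.
  have df := cone_diamonds (hom_comp qh fh).
  have dg := cone_diamonds (hom_comp qh gh).
  rewrite /comp true_eq in df.
  have false_eq := diamonds_unique KL wL df dg.
  have cone_eq n b : q (f (cone (Some (n, b)))) = q (g (cone (Some (n, b)))).
    by case: b; [have := congr1 (fun k => k n) true_eq|have := congr1 (fun k => k n) false_eq].
  case: (upset_tower_cases U) => [[V ->]|[[[n b]|] ->]|[n ->]] //.
  - have -> : cone None = chain_to_tower (up_top chain_le) by apply: upset_eq.
    exact: qfg.
  - by rewrite (hom_join fh) (hom_join gh) !(hom_join qh) !cone_eq.
apply/funext => U; apply: (le_anti BC); apply: contrapT.
  move=> /(separation KC)[L [q [KL wL qh q1 nq1]]].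
  by apply: nq1; rewrite -(agree L q U).
move=> /(separation KC)[L [q [KL wL qh q1 nq1]]].
by apply: nq1; rewrite (agree L q U).
Qed.

Lemma chain_layered : layered_brouwerian (brouwerian_reduct chain_algebra).
Proof. by apply: up_layered; [exact: leqnn|exact: chain_mate]. Qed.

Lemma tower_layered : layered_brouwerian (brouwerian_reduct tower_algebra).
Proof. by apply: up_layered; [exact: tower_refl|exact: tower_mate]. Qed.

Lemma tower_fsi : finitely_subdirectly_irreducible (brouwerian_reduct tower_algebra).
Proof.
apply: well_connected_fsi; first by have [] := tower_layered.
exact: (@up_well_connected _ _ tower_trans None).
Qed.

Definition tower_antichain : set (set tower_algebra) :=
  [set @points_filter _ _ tower_trans (Some (0, true));
       @points_filter _ _ tower_trans (Some (0, false))].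

Lemma tower_antichainP : [/\ tower_antichain `<=` @heyting_dual tower_algebra,
  antichain tower_antichain & `I_2 #<= tower_antichain].
Proof.
have nsub b : ~ (@points_filter _ _ tower_trans (Some (0, b)) `<=`
    @points_filter _ _ tower_trans (Some (0, ~~ b))).
  move=> /(_ (cone (Some (0, b)))) h.
  have /h : @points_filter _ _ tower_trans (Some (0, b)) (cone (Some (0, b))).
    exact: tower_refl.
  by rewrite /points_filter /upset_in /= ; case: (b).
split.
- by move=> _ [->|->]; apply: points_filter_dual.
- by move=> _ _ [->|->] [->|->] //= h; [case: (nsub true h)|case: (nsub false h)].
- by apply: card_ge2 => e; apply: (nsub true); rewrite e.
Qed.

(** * Heyting algebras *)

Definition layered_heyting (A : algebra heyting_signature) :=
  layered_brouwerian (brouwerian_reduct A) /\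
  forall x : brouwerian_reduct A, le (bot A : brouwerian_reduct A) x.

Fixpoint heyting_term (t : term brouwerian_signature) : term heyting_signature :=
  match t with
  | Var n => Var _ n
  | App f ts => @App heyting_signature (Brouwerian f) (fun i => heyting_term (ts i))
  end.

Lemma eval_heyting_term (A : algebra heyting_signature) (v : nat -> A) t :
  eval v (heyting_term t) = @eval _ (brouwerian_reduct A) v t.
Proof.
elim: t => [//|f ts IH] /=.
by congr (@op _ A (Brouwerian f) _); apply/funext => i; apply: IH.
Qed.

Lemma variety_layered_heyting : variety layered_heyting.
Proof.
have [E KE] := variety_layered_brouwerian.
exists (fun s t => forall A, layered_heyting A -> satisfies A s t) => A.
split=> [KA s t|H]; first exact.
split.
  apply/KE => s t Est v; rewrite -!eval_heyting_term.
  apply: (H (heyting_term s) (heyting_term t)) => B [/KE KB _] w.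
  by rewrite !eval_heyting_term; apply: KB.
move=> x.
pose t0 := @App heyting_signature Bot (@args0 _).
pose s := @App heyting_signature (Brouwerian Meet) (args2 t0 (Var _ 0)).
have evalE (B : algebra heyting_signature) (v : nat -> B) :
    eval v s = meet (bot B : brouwerian_reduct B) (v 0) /\ eval v t0 = bot B.
  have e0 : eval v t0 = bot B by rewrite /bot /=; congr (op _ _); apply: args0E.
  split=> //; rewrite /meet -e0 /=; congr (op _ _).
  exact: (comp_args2 (eval v) t0 (Var _ 0)).
have st : satisfies A s t0.
  by apply: H => B [_ b0] v; have [-> ->] := evalE B v; apply: b0.
by have := st (fun=> x); have [-> ->] := evalE A (fun=> x).
Qed.

Lemma hom_reduct (A B : algebra heyting_signature) (h : A -> B) : homomorphism h ->
  @homomorphism _ (brouwerian_reduct A) (brouwerian_reduct B) h.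
Proof. by move=> hh f args; apply: (hh (Brouwerian f)). Qed.

Lemma hom_bot (A B : algebra heyting_signature) (h : A -> B) : homomorphism h ->
  h (bot A) = bot B.
Proof. by move=> hh; rewrite /bot hh; congr (op _ _); apply: args0E. Qed.

Lemma congruence_reduct (A : algebra heyting_signature) (th : set (A * A)) :
  @congruence _ (brouwerian_reduct A) th <-> congruence th.
Proof.
split=> -[Rf Sy Tr Op]; split=> //; last by move=> f a b; apply: (Op (Brouwerian f)).
by case=> [f|] a b ab; [apply: (Op f)|rewrite (args0E a b); apply: Rf].
Qed.

Lemma fsi_reduct (A : algebra heyting_signature) :
  finitely_subdirectly_irreducible (brouwerian_reduct A) <->
  finitely_subdirectly_irreducible A.
Proof.
by split=> fsi th1 th2 C1 C2; apply: fsi; apply/congruence_reduct.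
Qed.

Lemma generated_reduct (A : algebra heyting_signature) (X : set A) :
  generated (X `|` [set bot A]) = [set: A] ->
  @generated _ (brouwerian_reduct A) (X `|` [set bot A]) = [set: A].
Proof.
move=> genX; apply/seteqP; split=> // x _; move: x.
apply: (generated_ind genX); last by apply: sub_smallest.
case=> [f|] args argsX.
  exact: (@generated_subuniverse _ (brouwerian_reduct A) _ f).
by apply: (@sub_smallest _ _ _ [set bot A]); [right|congr (op _ _); apply: args0E].
Qed.

Lemma locally_finite_layered_heyting : locally_finite layered_heyting.
Proof.
move=> A [KA _] [X finX genX].
apply: (locally_finite_layered_brouwerian KA).
exists (X `|` [set bot A]); first by rewrite finite_setU; split.
apply: generated_reduct; apply/seteqP; split=> // x _; move: x.
apply: (generated_ind genX); first exact: generated_subuniverse.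
by apply: sub_smallest; left.
Qed.

(** A Brouwerian homomorphism [f] from a Heyting algebra is a Heyting homomorphism
    to its target once [f bot] is made the constant; two homomorphisms which agree
    at [bot] may share this target. *)
Definition expand (C : algebra brouwerian_signature) (c : C) : algebra heyting_signature :=
  @Algebra heyting_signature C (fun f =>
    match f return ('I_(heyting_arity f) -> C) -> C with
    | Brouwerian g => @op _ C g
    | Bot => fun=> c
    end).

Lemma hom_expand (A : algebra heyting_signature) (C : algebra brouwerian_signature)
    (h : A -> C) : @homomorphism _ (brouwerian_reduct A) C h ->
  forall c, h (bot A) = c -> @homomorphism _ A (expand c) h.
Proof.
move=> hh c hc [f|] args; first exact: hh.
by rewrite /= -hc /bot; congr (h (op _ _)); apply: args0E.
Qed.

Lemma weak_ES_layered_heyting : weak_ES_property layered_heyting.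
Proof.
move=> A B h KA KB hh [b genB] epi; apply: (almost_onto_range hh genB).
apply: contrapT => nb; have [[BB _] _] := KB.
have hbot : range h (bot B) by exists (bot A); rewrite // hom_bot.
have absorb : range h `|` [set b] = (range h `|` [set b]) `|` [set bot B].
  apply/seteqP; split=> x; first by move=> Zx; left.
  by case=> [//|->]; left.
have genB' : @generated _ (brouwerian_reduct B) (range h `|` [set b]) = [set: B].
  by rewrite absorb; apply: generated_reduct; rewrite -absorb.
have [C [f [g [fh gh fs fg fb]]]] :=
  proper_almost_onto_not_epi BB (range_subuniverse (hom_reduct hh)) genB' nb.
have fH : @homomorphism _ B (expand (f (bot B))) f by apply: hom_expand.
have gH : @homomorphism _ B (expand (f (bot B))) g.
  by apply: hom_expand => //; rewrite fg.
apply: fb; congr (_ b); apply: (epi (expand (f (bot B)))) => //.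
  exact: (variety_image variety_layered_heyting fH fs KB).
by apply/funext => x /=; apply: fg; exists x.
Qed.

Lemma width_layered_brouwerian : has_width brouwerian_dual layered_brouwerian 2.
Proof.
split=> [A KA fsi X XP|m bound].
  by apply: prime_antichain => //; apply: fsi_well_connected (proj1 KA) fsi.
have [XP acX X2] := tower_antichainP.
rewrite -card_le_II; apply: card_le_trans X2 _.
apply: (bound _ tower_layered tower_fsi) => // F /XP[]//.
Qed.

Lemma width_layered_heyting : has_width heyting_dual layered_heyting 2.
Proof.
split=> [A [KA _] /fsi_reduct fsi X XP|m bound].
  apply: (prime_antichain KA); first by apply: fsi_well_connected (proj1 KA) fsi.
  by move=> F /XP[].
have [XP acX X2] := tower_antichainP.
rewrite -card_le_II; apply: card_le_trans X2 _.
apply: (bound tower_algebra) => //; last by apply/fsi_reduct/tower_fsi.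
by split; [exact: tower_layered|have [] := up_heyting tower_refl tower_trans].
Qed.

Theorem corollary6p2 :
  (exists K : algebra brouwerian_signature -> Prop,
     variety K /\ (forall A, K A -> brouwerian_algebra A) /\ locally_finite K /\
     has_width brouwerian_dual K 2 /\
     weak_ES_property K /\ ~ ES_property K) /\
  (exists K : algebra heyting_signature -> Prop,
     variety K /\ (forall A, K A -> heyting_algebra A) /\ locally_finite K /\
     has_width heyting_dual K 2 /\
     weak_ES_property K /\ ~ ES_property K).
Proof.
split.
- exists layered_brouwerian; split; first exact: variety_layered_brouwerian.
  split; first by move=> A [].
  split; first exact: locally_finite_layered_brouwerian.
  split; first exact: width_layered_brouwerian.
  split; first exact: weak_ES_layered_brouwerian.
  move=> ES; apply: chain_to_tower_proper.
  exact: (ES _ _ _ chain_layered tower_layered (hom_reduct chain_to_tower_hom)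
    chain_to_tower_epi).
- exists layered_heyting; split; first exact: variety_layered_heyting.
  split; first by move=> A [[BA _] botA].
  split; first exact: locally_finite_layered_heyting.
  split; first exact: width_layered_heyting.
  split; first exact: weak_ES_layered_heyting.
  move=> ES; apply: chain_to_tower_proper; apply: ES chain_to_tower_hom _.
  + by split; [exact: chain_layered|have [] := up_heyting leqnn chain_trans].
  + by split; [exact: tower_layered|have [] := up_heyting tower_refl tower_trans].
  + move=> C [KC _] f g /hom_reduct fh /hom_reduct gh.
    exact: (chain_to_tower_epi KC).
Qed.
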